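(* Let $f,g$ be non-negative integers and $\mu\in\mathcal P_{f,g}$. Then in $M^{(f,g)}$, \[t_\mu m=\sum_{\lambda\in\mathcal P_{f,g}}\mathrm i_{\lambda\mu}\,s_\lambda m.\]
   Context: $\mathbb F$ is any field, $k=f+g$, $\mathfrak S_k$ has Coxeter generators $t_i=(i\ i{+}1)$ and $s_i=t_i-1\in\mathbb F\mathfrak S_k$. $M^{(f,g)}=\langle m\mid t_im=m\ (i\ne f)\rangle$ as an $\mathbb F\mathfrak S_k$-module. $\mathcal P_{f,g}$ is the set of partitions with at most $g$ nonzero parts, all at most $f$. For $\lambda\in\mathcal P_{f,g}$, $t_\lambda=\prod_{r=1}^{g}(t_{\lambda_r+g-r+1}t_{\lambda_r+g-r+2}\cdots t_{f+g-r})$ with $r=1$ leftmost (a factor is empty if $\lambda_r=f$), and $s_\lambda$ is given by the same formula with each $t_i$ replaced by $s_i$. Partitions are identified with Young diagrams $\{(a,b)\in\mathbb N^2:b\le\lambda_a\}$; nodes are elements of $\mathbb N^2$; $(a,b)$ has height $a+b$ and lies in column $b-a$ (smaller column = further left). $\mathtt{NE}(\mathfrak n)=\mathfrak n+(0,1)$, $\mathtt{SE}(\mathfrak n)=\mathfrak n-(1,0)$, $\mathtt N(\mathfrak n)=\mathfrak n+(1,1)$. A tile is a finite nonempty set of nodes orderable $\mathfrak n_1,\dots,\mathfrak n_r$ with $\mathfrak n_{i+1}\in\{\mathtt{NE}(\mathfrak n_i),\mathtt{SE}(\mathfrak n_i)\}$; start = leftmost node, end = rightmost node; Dyck tile if start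 and end both attain the maximal height of its nodes. A Dyck tiling of $\lambda\setminus\mu$ ($\lambda\supseteq\mu$) is a partition of it into Dyck tiles; it is cover-inclusive if whenever $\mathfrak a,\mathtt N(\mathfrak a)\in\lambda\setminus\mu$, the tile of $\mathtt N(\mathfrak a)$ starts weakly left of and ends weakly right of the tile of $\mathfrak a$. $\mathrm i_{\lambda\mu}$ is the number of cover-inclusive Dyck tilings of $\lambda\setminus\mu$ if $\lambda\supseteq\mu$, and $0$ otherwise. *)

(* Defs.v *)
From HB Require Import structures.
From mathcomp Require Import all_boot all_order all_algebra.
Set Implicit Arguments. Unset Strict Implicit. Unset Printing Implicit Defensive.
Import GRing.Theory.

(* A partition with at most g nonzero parts, all at most f, is recorded as the
   g-tuple (lambda_1, ..., lambda_g) (padded with zeros), weakly decreasing. *)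
Definition part (f g : nat) := (g.-tuple 'I_f.+1)%type.
Definition is_part f g (lam : part f g) : bool :=
  sorted (fun x y : nat => y <= x) (map val lam).
(* prt lam r = lambda_r  (r >= 1; equals 0 for r > g) *)
Definition prt f g (lam : part f g) (r : nat) : nat := nth 0 (map val lam) r.-1.

(* Nodes (a,b) in N^2; all nodes of diagrams in P_{f,g} satisfy a <= g, b <= f. *)
Definition node (f g : nat) := ('I_g.+1 * 'I_f.+1)%type.
Definition height f g (x : node f g) : nat := x.1 + x.2.
(* column b - a, shifted by g so as to be a natural number (same order) *)
Definition colN f g (x : node f g) : nat := x.2 + g - x.1.

Definition ydiag f g (lam : part f g) : {set node f g} :=
  [set x : node f g | [&& 0 < x.1, 0 < x.2 & x.2 <= prt lam x.1]].
Definition skew f g (lam mu : part f g) : {set node f g} :=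
  ydiag lam :\: ydiag mu.

(* y = NE(x) = x + (0,1)  or  y = SE(x) = x - (1,0) *)
Definition tstep f g (x y : node f g) : bool :=
  ((val y.1 == val x.1) && (val y.2 == (val x.2).+1)) ||
  (((val y.1).+1 == val x.1) && (val y.2 == val x.2)).

Definition is_tile f g (T : {set node f g}) : bool :=
  (T != set0) &&
  [exists s : #|T|.-tuple (node f g), (T == [set x in s]) && sorted (@tstep f g) s].

Definition tstart f g (T : {set node f g}) : node f g :=
  odflt (ord0, ord0) [pick x in T | [forall z in T, colN x <= colN z]].
Definition tend f g (T : {set node f g}) : node f g :=
  odflt (ord0, ord0) [pick x in T | [forall z in T, colN z <= colN x]].

Definition is_dyck f g (T : {set node f g}) : bool :=
  [&& is_tile T,
      height (tstart T) == \max_(x in T) height x &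
      height (tend T) == \max_(x in T) height x].

Definition dyck_tiling f g (P : {set {set node f g}}) (D : {set node f g}) : bool :=
  partition P D && [forall T in P, is_dyck T].

Definition cover_incl f g (P : {set {set node f g}}) (D : {set node f g}) : bool :=
  [forall x : node f g, forall y : node f g,
    [&& val y.1 == (val x.1).+1, val y.2 == (val x.2).+1, x \in D & y \in D] ==>
    (colN (tstart (pblock P y)) <= colN (tstart (pblock P x))) &&
    (colN (tend (pblock P x)) <= colN (tend (pblock P y)))].

Definition iDT f g (lam mu : part f g) : nat :=
  if ydiag mu \subset ydiag lam then
    #|[set P : {set {set node f g}} |
        dyck_tiling P (skew lam mu) && cover_incl P (skew lam mu)]|
  else 0.

(* M^{(f,g)} is realised as the permutation module of S_k (k = f+g) on subsets
   of {0,...,k-1} (0-based points): v(B) is the coefficient of the basis vector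
   e_B, and sigma . e_B = e_{sigma(B)}.  The generator m is e_{{0..f-1}}; the
   cyclic submodule it generates is the induced module from S_f x S_g, i.e.
   the module <m | t_i m = m (i <> f)>. *)
Notation pmod F k := {ffun {set 'I_k} -> GRing.Field.sort F} (only parsing).

(* the 0-based transposition (i-1 i), i.e. the 1-based t_i = (i i+1) *)
Definition swapn (i n : nat) : nat :=
  if n == i.-1 then i else if n == i then i.-1 else n.
Definition ptswap k (i : nat) (x : 'I_k) : 'I_k := insubd x (swapn i x).

(* action of t_i (an involution): (t_i v)(B) = v(t_i^{-1} B) = v(t_i B) *)
Definition tact (F : fieldType) k (i : nat) (v : pmod F k) : pmod F k :=
  [ffun B : {set 'I_k} => v (ptswap i @: B)].
Definition sact (F : fieldType) k (i : nat) (v : pmod F k) : pmod F k :=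
  (tact i v - v)%R.

Definition tw_act (F : fieldType) k (w : seq nat) (v : pmod F k) : pmod F k :=
  foldr (@tact F k) v w.
Definition sw_act (F : fieldType) k (w : seq nat) (v : pmod F k) : pmod F k :=
  foldr (@sact F k) v w.

Definition mgen (F : fieldType) (f g : nat) : pmod F (f + g) :=
  [ffun B => if B == [set x : 'I_(f + g) | val x < f] then 1%R else 0%R].

(* indices of t_lambda = prod_{r=1}^g (t_{lam_r+g-r+1} ... t_{f+g-r}), r=1 leftmost *)
Definition word f g (lam : part f g) : seq nat :=
  flatten [seq iota (prt lam r + g - r + 1) (f - prt lam r) | r <- iota 1 g].

(* Main.v *)
Require Import Defs.
From HB Require Import structures.
From mathcomp Require Import all_boot all_order all_algebra.
From mathcomp Require Import zify.
Import GRing.Theory.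

(**
A partition in [P_{f,g}] is its boundary word in f letters U ([true]) and g
letters D ([false]), and a basis vector of the permutation module is such a
word.  Then [t_mu m] is the basis vector of the word of [mu].  The [s_i] act on
tensor words as Temperley-Lieb generators, so [s_lambda m] is a product of
singlets DU - UD over the matched pairs D ... U (the chords) of the word of
[lambda], the unmatched letters being fixed.

In a cover-inclusive Dyck tiling of [lambda \ mu] every tile is a translate of a
piece of the rim of [lambda], so the tiling is encoded by the numbers [n_c] of
tiles running through the c-th step of the rim.  These numbers are exactly the
labellings of the chords of [lambda] that weakly increase inwards and are bounded
by the vertical distance between [lambda] and [mu].

Both sides are then compared by deleting the first letter of the words.  If D^
denotes the prefixed letter, D^ v_lambda = v_(D lambda) + sum U^ v_kappa over the
kappa obtained from lambda by turning an unmatched U into D; on labellings the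
same relation is obtained by splitting at the first outermost chord with label 0
and decreasing the labels to its left by one.
*)

(** * Words and coefficients of singlet products *)

Fixpoint words (n : nat) : seq (seq bool) :=
  if n is n'.+1 then map (cons true) (words n') ++ map (cons false) (words n')
  else [:: [::]].

Lemma mem_words n w : (w \in words n) = (size w == n).
Proof.
elim: n w => [|n IHn] [|b w] //=; rewrite mem_cat.
  by apply/negbTE/norP; split; apply/mapP; case.
apply/orP/eqP => [[] /mapP[w' w'n [_ ->]] | [sw]].
- by move: w'n; rewrite IHn => /eqP->.
- by move: w'n; rewrite IHn => /eqP->.
by case: b; [left | right]; apply/map_f; rewrite IHn sw.
Qed.

Lemma words_uniq n : uniq (words n).
Proof.
elim: n => //= n IHn.
have injc b : injective (cons b : seq bool -> seq bool) by move=> ? ? [].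
rewrite cat_uniq !map_inj_uniq // IHn /= andbT.
by apply/hasPn => _ /mapP[w _ ->]; apply/mapP; case.
Qed.

(* All words obtained from [la] by turning a U unmatched in D^m [la] into D;
   [unflips] is the inverse relation. *)
Fixpoint flips m (la : seq bool) : seq (seq bool) :=
  match la with
  | [::] => [::]
  | false :: la' => map (cons false) (flips m.+1 la')
  | true :: la' =>
      if m is m'.+1 then map (cons true) (flips m' la')
      else (false :: la') :: map (cons true) (flips 0 la')
  end.

Fixpoint unflips m (la : seq bool) : seq (seq bool) :=
  match la with
  | [::] => [::]
  | true :: la' => map (cons true) (unflips m.-1 la')
  | false :: la' =>
      if m is _.+1 then map (cons false) (unflips m.+1 la')
      else (true :: la') :: map (cons false) (unflips 1 la')
  end.

(** The changed letter sits at depth 0, and the depth depends only on the prefix before it, which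
    both words share. Hence the two recursions run in parallel and list the same pairs. *)
Lemma exchange_flips (V : nmodType) (G : seq bool -> seq bool -> V) n m :
  (\sum_(ka <- words n) \sum_(la <- unflips m ka) G ka la =
   \sum_(la <- words n) \sum_(ka <- flips m la) G ka la)%R.
Proof.
elim: n m G => [|n IHn] m G /=; first by rewrite !big_seq1 !big_nil.
rewrite !big_cat !big_map /=.
under eq_bigr do rewrite big_map.
rewrite [X in (X + _)%R](IHn _ (fun ka la => G (true :: ka) (true :: la))).
under [X in _ = (_ + X)%R]eq_bigr do rewrite big_map.
rewrite -[X in _ = (_ + X)%R](IHn _ (fun ka la => G (false :: ka) (false :: la))).
case: m => [|m] /=.
  under [X in (_ + X)%R = _]eq_bigr do rewrite big_cons big_map.
  under [X in _ = (X + _)%R]eq_bigr do rewrite big_cons big_map.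
  by rewrite !big_split /= addrCA addrA.
under [X in (_ + X)%R = _]eq_bigr do rewrite big_map.
by under [X in _ = (X + _)%R]eq_bigr do rewrite big_map.
Qed.

Section Ev.
Variable R : pzRingType.
Local Open Scope ring_scope.

(* The coefficient of the word [w] in the singlet product of [la].  The stack
   holds the letters of [w] at the currently open D's of [la]; an empty stack
   behaves as an infinite supply of D's, so that an unmatched U of [la] is treated
   as matched with a virtual D on its left. *)
Fixpoint cup_coef (st la w : seq bool) : R :=
  match la, w with
  | true :: la', b :: w' => (b%:R - (head false st)%:R) * cup_coef (behead st) la' w'
  | false :: la', b :: w' => cup_coef (b :: st) la' w'
  | _, _ => (~~ has id st)%:R
  end.

Lemma cup_coef_rcons_false st la w : cup_coef (rcons st false) la w = cup_coef st la w.
Proof.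
have st0 s : has id (rcons s false) = has id s by rewrite has_rcons.
elim: la st w => [|a la IHla] st [|b w] /=; rewrite ?st0 //; case: a => //.
  by case: st => [|c st] /=; [rewrite -[[::]]/(behead [::]) | rewrite IHla].
by rewrite -rcons_cons IHla.
Qed.

(** The bottom [true] is the letter U read at a D prefixed to [la]. If no U of [la] closes it, both
    sides vanish. At the U that does, the factor is [b - 1], while flipping this U gives [cup_coef
    [:: b]] and the later flips resum to [- b] times [cup_coef [:: true]]. *)
Lemma cup_coef_flips st la w : size la = size w ->
  cup_coef (rcons st true) la w = - \sum_(ka <- flips (size st) la) cup_coef st ka w.
Proof.
elim: la st w => [|a la IHla] st [|b w] //= => [_|[sz]].
  by rewrite big_nil has_rcons /= oppr0.
case: a; last by rewrite -rcons_cons IHla // big_map.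
case: st => [|c st] /=; last by rewrite IHla // big_map mulrN -mulr_sumr.
rewrite big_cons big_map /= -mulr_sumr subr0.
have -> : \sum_(ka <- flips 0 la) cup_coef [::] ka w = - cup_coef [:: true] la w.
  by rewrite -[[:: true]]/(rcons [::] true) IHla // opprK.
rewrite -(cup_coef_rcons_false [::]) /=.
case: b => /=; rewrite ?mulr0n ?mulr1n ?subrr ?sub0r ?subr0 ?mul1r ?mulN1r ?mul0r.
  by rewrite subrr oppr0.
by rewrite addr0.

Qed.

(* The Pluecker relation (c,b2) b1 - (c,b1) b2 = (b1,b2) c between singlets. *)
Lemma cup_coef_swap st x y w1 b1 b2 w2 : size x = size w1 ->
  cup_coef st (x ++ [:: true, false & y]) (w1 ++ [:: b2, b1 & w2]) -
  cup_coef st (x ++ [:: true, false & y]) (w1 ++ [:: b1, b2 & w2]) =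
  cup_coef st (x ++ [:: false, true & y]) (w1 ++ [:: b1, b2 & w2]).
Proof.
elim: x st w1 => [|a x IHx] st [|b w1] //= => [_|[sz]]; last first.
  by case: a; [rewrite -mulrBr IHx | rewrite IHx].
(* The virtual D of an empty stack is made explicit, so that both sides are multiples of one
   coefficient. *)
have -> : cup_coef st y w2 = cup_coef (head false st :: behead st) y w2.
  by case: st => //=; rewrite -(cup_coef_rcons_false [::]).
case: b1 b2 (head false st) => [] [] [];
  rewrite /= ?mulr0n ?mulr1n ?subrr ?subr0 ?sub0r ?mul0r ?mul1r ?mulN1r
          ?subrr ?subr0 ?sub0r ?opprK //.
Qed.

End Ev.

(* The chord labellings of [la], listed letter by letter (both ends of a chord
   carry its label, unmatched letters carry 0), where [d] is the current value of
   #U([la]) - #U([mu]) and the stack holds the labels of the open D's of [la]. *)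
Fixpoint labelings (st : seq nat) (d : nat) (la mu : seq bool) : seq (seq nat) :=
  match la, mu with
  | true :: la', b :: mu' =>
      if head 0 st <= d
      then map (cons (head 0 st)) (labelings (behead st) (d + ~~ b) la' mu')
      else [::]
  | false :: la', b :: mu' =>
      if b <= d then
        [seq n :: s | n <- index_iota (head 0 st) (d - b).+1,
                      s <- labelings (n :: st) (d - b) la' mu']
      else [::]
  | _, _ => if (d == 0) && all (pred1 0) st then [:: [::]] else [::]
  end.

Definition nb_labelings st d la mu := size (labelings st d la mu).

Lemma nb_labelings_false st d la b mu :
  nb_labelings st d (false :: la) (b :: mu) =
  if b <= d then \sum_(head 0 st <= n < (d - b).+1) nb_labelings (n :: st) (d - b) la mu
  else 0.
Proof.
rewrite /nb_labelings /=; case: leqP => // _.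
by rewrite size_allpairs_dep sumnE big_map.
Qed.

Lemma nb_labelings_true st d la b mu :
  nb_labelings st d (true :: la) (b :: mu) =
  if head 0 st <= d then nb_labelings (behead st) (d + ~~ b) la mu else 0.
Proof. by rewrite /nb_labelings /=; case: leqP => // _; rewrite size_map. Qed.

Lemma nb_labelings_rcons0 st d la mu :
  nb_labelings (rcons st 0) d la mu = nb_labelings st d la mu.
Proof.
have st0 s : all (pred1 0) (rcons s 0) = all (pred1 0) s by rewrite all_rcons.
have hd0 s : head 0 (rcons s 0) = head 0 s by case: s.
elim: la st d mu => [|a la IHla] st d mu; first by rewrite /nb_labelings /= st0.
case: mu => [|b mu]; first by case: a; rewrite /nb_labelings /= st0.
case: a.
  by rewrite !nb_labelings_true hd0; case: st => [|c st] //=; rewrite IHla.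
rewrite !nb_labelings_false hd0; case: leqP => // _.
by apply: eq_bigr => n _; rewrite -rcons_cons IHla.
Qed.

(* With [d.+1] in place of [d], peel off the first outermost D with label 0: turning
   it into U, and lowering all labels before it by one, gives the right-hand side. *)
Lemma nb_labelings_unflips st d ka mu : size ka = size mu ->
  nb_labelings (map succn st) d.+1 ka mu =
  \sum_(la <- unflips (size st) ka) nb_labelings st d la mu.
Proof.
elim: ka st d mu => [|a ka IHka] st d [|b mu] //= => [_|[sz]].
  by rewrite big_nil.
case: a.
  rewrite big_map nb_labelings_true.
  under eq_bigr do rewrite nb_labelings_true.
  case: st => [|c st] /=; rewrite addSn ?ltnS.
    by rewrite -(IHka [::]).
  by case: leqP; rewrite ?big1_eq // -IHka.
have small n : b <= d ->
    \sum_(n <= i < (d - b).+1) nb_labelings (map succn (i :: st)) (d - b).+1 ka mu =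
    \sum_(n <= i < (d - b).+1)
      \sum_(la <- unflips (size st).+1 ka) nb_labelings (i :: st) (d - b) la mu.
  by move=> _; apply: eq_bigr => i _; rewrite IHka.
(* Here the D is kept: its label is at least [n.+1] on the left, and lowering it by one gives the
   labels on the right. *)
have big n : head 0 st = n ->
    (if b <= d.+1 then
       \sum_(n.+1 <= i < (d.+1 - b).+1) nb_labelings (i :: map succn st) (d.+1 - b) ka mu
     else 0) =
    \sum_(la <- map (cons false) (unflips (size st).+1 ka)) nb_labelings st d la (b :: mu).
  move=> hn; rewrite big_map.
  under [RHS]eq_bigr do rewrite nb_labelings_false hn.
  case: (leqP b d) => [bd | db].
    by rewrite leqW // subSn // big_add1 /= small // exchange_big.
  rewrite big1_eq; case: ifP => // bd1.
  by rewrite big_geq //; move: (leq_b1 b) db; clear; lia.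
rewrite nb_labelings_false.
case: st small big => [|c st] /= small big; last exact: big.
(* With an empty stack the D may also have label 0. It is then the peeled one: it becomes U on the
   right, and the 0 pushed on the left has no effect. *)
rewrite big_cons -(big 0) // nb_labelings_true /=.
have -> : b <= d.+1 by case: b {small big}.
rewrite big_ltn // -[[:: 0]]/(rcons [::] 0) nb_labelings_rcons0; congr (nb_labelings _ _ _ _ + _).
by case: b {small big} => /=; rewrite ?subn1 ?addn0 // subn0 addn1.
Qed.

(** The theorem read off at one basis vector [w], by induction on the first letter. If [mu] starts
    with U, only words starting with U have labellings. If it starts with D, the words starting with
    U continue with [d = 1]; their sum cancels the rest when [w] starts with U and has factor 0
    otherwise. *)
Theorem sum_cup_coef_labelings (R : pzRingType) (mu w : seq bool) : size mu = size w ->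
  (\sum_(la <- words (size mu)) cup_coef R [::] la w *+ nb_labelings [::] 0 la mu =
   (w == mu)%:R)%R.
Proof.
elim: mu w => [|b mu IHmu] [|c w] //= => [_|[sz]]; first by rewrite big_seq1.
rewrite eqseq_cons big_cat !big_map /= subr0.
under eq_bigr do rewrite nb_labelings_true /= add0n -mulrnAr.
under [X in (_ + X)%R]eq_bigr do rewrite nb_labelings_false.
rewrite -mulr_sumr; case: b => /=.
  rewrite [X in (_ + X)%R]big1 // addr0 IHmu //.
  by case: c; rewrite ?mul1r ?mul0r.
under [X in (_ + X)%R]eq_bigr do
  rewrite subn0 big_nat1 -[[:: 0]]/(rcons [::] 0) nb_labelings_rcons0.
(* The flip relations for labellings and for coefficients meet here: the first replaces [d = 1] by
   [d = 0], the second resums over [ka] with a sign. *)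
have -> : (\sum_(ka <- words (size mu)) cup_coef R [::] ka w *+ nb_labelings [::] 1 ka mu =
           - \sum_(la <- words (size mu)) cup_coef R [:: true] la w *+ nb_labelings [::] 0 la mu)%R.
  rewrite -sumrN big_seq.
  under eq_bigr => ka.
    rewrite mem_words => /eqP ska.
    rewrite (nb_labelings_unflips [::]) // -sumrMnr.
  over.
  rewrite -big_seq (exchange_flips _ (fun ka la => cup_coef R [::] ka w *+ nb_labelings [::] 0 la mu)%R).
  rewrite big_seq [RHS]big_seq; apply: eq_bigr => la.
  rewrite mem_words => /eqP sla.
  by rewrite -[[:: true]]/(rcons [::] true) cup_coef_flips ?sla // mulNrn opprK sumrMnl.
case: c; rewrite /= ?mul1r ?addNr // mul0r add0r /= -IHmu //.
by apply: eq_bigr => la _; rewrite -[[:: false]]/(rcons [::] false) cup_coef_rcons_false.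
Qed.

(** * The permutation module *)

(** The boundary is read from the last row to the first; the D of a row of length [x] is preceded by
    exactly [x] letters U. *)
Fixpoint rows_word (f : nat) (l : seq nat) : seq bool :=
  if l is x :: l' then rows_word x l' ++ false :: nseq (f - x) true
  else nseq f true.

Fixpoint rows_gens (f : nat) (l : seq nat) : seq nat :=
  if l is x :: l' then iota (x + size l').+1 (f - x) ++ rows_gens f l' else [::].

Lemma rows_word_widen x f l : head 0 l <= x -> x <= f ->
  rows_word f l = rows_word x l ++ nseq (f - x) true.
Proof.
case: l => [|z l] /= zx xf; first by rewrite -nseqD subnKC.
by rewrite -catA cat_cons -nseqD; congr (_ ++ _ :: nseq _ _); lia.
Qed.

Lemma path_geq_head f l : path geq f l -> head 0 l <= f.
Proof. by case: l => //= x l /andP[]. Qed.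

Lemma size_rows_word f l : path geq f l -> size (rows_word f l) = f + size l.
Proof.
elim: l f => [|x l IHl] f /=; first by rewrite size_nseq addn0.
by case/andP=> xf /IHl sl; rewrite size_cat /= sl size_nseq; move: xf => /=; lia.
Qed.

Lemma count_rows_word f l : path geq f l -> count id (rows_word f l) = f.
Proof.
elim: l f => [|x l IHl] f /=; first by rewrite count_nseq mul1n.
by case/andP=> /= xf /IHl cl; rewrite count_cat /= cl count_nseq mul1n add0n subnKC.
Qed.

(** A prefix of length [b + size l - a] has at least [b] letters U iff it has at most [size l - a]
    letters D, i.e. iff it stops before the D of row [a]. This length is the shifted column of the
    node [(a, b)]. *)
Lemma leq_row f l a b : path geq f l -> 0 < a <= size l -> b <= f ->
  (b <= nth 0 l a.-1) = (b <= count id (take (b + size l - a) (rows_word f l))).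
Proof.
elim: l f a => [|x l IHl] f a /=; first by case: a.
case/andP=> /= xf pl /andP[a0 al] bf; have sl := size_rows_word _ _ pl.
have lx i : nth 0 l i <= x.
  case: (ltnP i (size l)) => [il | ?]; last by rewrite nth_default.
  by have /allP := order_path_min (rev_trans leq_trans) pl; apply; rewrite mem_nth.
case: (leqP b x) => bx.
  rewrite takel_cat; last by lia.
  case: a a0 al => [|[|a]] //= _ al; last by rewrite (IHl x a.+1) // addnS subSS.
  rewrite bx; set t := take _ _.
  have : count (predC id) t <= count (predC id) (rows_word x l).
    by apply/leq_count_subseq/take_subseq.
  have := count_predC id t; have := count_predC id (rows_word x l).
  rewrite sl count_rows_word // size_takel ?sl; lia.
have -> : (b <= nth 0 (x :: l) a.-1) = false.
  by apply/negbTE; rewrite -ltnNge; case: a.-1 => //= n; apply: leq_ltn_trans bx.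
apply/esym/negbTE; rewrite -ltnNge.
case: (leqP (b + (size l).+1 - a) (x + size l)) => cx.
  rewrite takel_cat ?sl //.
  apply: leq_ltn_trans bx; rewrite -[leqRHS](count_rows_word x l) //.
  exact/leq_count_subseq/take_subseq.
rewrite take_cat sl; case: (ltnP _ (x + _)) => [|_]; first lia.
rewrite count_cat count_rows_word //.
case e : (_ - _) => [|n] /=; first lia.
by rewrite take_nseq ?count_nseq; lia.
Qed.

Lemma rows_word_inj f l1 l2 : path geq f l1 -> path geq f l2 ->
  rows_word f l1 = rows_word f l2 -> l1 = l2.
Proof.
move=> p1 p2 e.
have s12 : size l1 = size l2.
  by have := congr1 size e; rewrite !size_rows_word // => /addnI.
have bnd l i : path geq f l -> nth 0 l i <= f.
  move=> pl; case: (ltnP i (size l)) => [il | ?]; last by rewrite nth_default.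
  by have /allP := order_path_min (rev_trans leq_trans) pl; apply; rewrite mem_nth.
apply: (@eq_from_nth _ 0) => // i il; apply/eqP.
have key b : b <= f -> (b <= nth 0 l1 i) = (b <= nth 0 l2 i).
  move=> bf; have il2 : i < size l2 by rewrite -s12.
  by rewrite (leq_row f l1 i.+1) // (leq_row f l2 i.+1) // e s12.
by rewrite eqn_leq -key ?bnd // leqnn key ?bnd // leqnn.
Qed.

(** Induction on the last letter: a final U lowers [f], a final D is a first row of full length
    [f]. *)
Lemma rows_word_surj f g w : size w = f + g -> count id w = f ->
  exists l, [/\ size l = g, path geq f l & rows_word f l = w].
Proof.
elim/last_ind: w f g => [|w b IHw] f g.
  by case: f g => [|f] [|g] // _ _; exists [::].
rewrite size_rcons -cats1 count_cat /= addn0; case: b => /= sw cw.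
  have [//||l [sl pl <-]] := IHw f.-1 g; [lia | lia | exists l].
  have pl' : path geq f l.
    by case: l pl {sl} => //= x l /andP[/= xf ->]; rewrite andbT; lia.
  split=> //; rewrite (rows_word_widen f.-1) ?path_geq_head //; last by lia.
  by rewrite (_ : f - f.-1 = 1) //; lia.
case: g sw => [|g] sw.
  have := count_size id w; lia.
have [||l [sl pl <-]] := IHw f g; [lia | lia | exists (f :: l)].
by rewrite /= sl leqnn pl subnn.
Qed.

Lemma rows_gensE f s :
  flatten [seq iota (nth 0 s r.-1 + size s - r + 1) (f - nth 0 s r.-1)
          | r <- iota 1 (size s)] = rows_gens f s.
Proof.
elim: s => //= x s <-; rewrite -addnBA // subn1 addn1; congr (_ ++ flatten _).
rewrite (iotaDl 1 1) -map_comp; apply/eq_in_map => r; rewrite mem_iota => r1 /=.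
case: r r1 => // r _ /=; congr iota; lia.
Qed.

(** * Building a boundary word by adjacent exchanges, for [tact] and [sact] alike *)

Section FoldWord.
Variables (T : Type) (op : nat -> T -> T) (Psi : seq bool -> T) (k : nat).
Hypothesis opP : forall x y, size x + (size y).+2 = k ->
  op (size x).+1 (Psi (x ++ [:: true, false & y])) =
  Psi (x ++ [:: false, true & y]).

(** The rightmost operator acts first, so the D travels left past the U's one at a time. *)
Lemma foldr_iota e x y : size x + e + (size y).+1 = k ->
  foldr op (Psi (x ++ nseq e true ++ false :: y)) (iota (size x).+1 e) =
  Psi (x ++ false :: nseq e true ++ y).
Proof.
elim: e x => //= e IHe x sz.
have := IHe (rcons x true); rewrite !cat_rcons size_rcons => -> //; last by lia.
by apply: opP; rewrite size_cat size_nseq; lia.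
Qed.

(** The last row is placed first; then the D of each earlier row moves left over the [f - x] final
    U's to its place. *)
Lemma foldr_rows_gens f l y : path geq f l -> f + size l + size y = k ->
  foldr op (Psi (nseq f true ++ nseq (size l) false ++ y)) (rows_gens f l) =
  Psi (rows_word f l ++ y).
Proof.
elim: l y => //= x l IHl y /andP[/= xf pl] sz.
have pl' : path geq f l.
  by case: l pl {IHl sz} => //= z l /andP[/= zx ->]; rewrite andbT (leq_trans zx).
rewrite foldr_cat.
rewrite (_ : false :: nseq (size l) false ++ y = nseq (size l) false ++ false :: y); last first.
  by elim: (size l) => //= n ->.
rewrite IHl //=; last by lia.
rewrite (rows_word_widen x) ?path_geq_head // -!catA -size_rows_word // foldr_iota //.
by rewrite size_rows_word //; lia.
Qed.
End FoldWord.

(** * The action of the generators on functions of words *)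

Section Module.
Variable F : fieldType.
Local Open Scope ring_scope.

Definition inword {k} (B : {set 'I_k}) : seq bool := [seq x \in B | x <- enum 'I_k].

Lemma size_inword k (B : {set 'I_k}) : size (inword B) = k.
Proof. by rewrite size_map size_enum_ord. Qed.

Lemma nth_inword k (B : {set 'I_k}) (x : 'I_k) : nth false (inword B) x = (x \in B).
Proof. by rewrite (nth_map x) ?size_enum_ord // nth_ord_enum. Qed.

Lemma inword_inj k : injective (@inword k).
Proof. by move=> A B e; apply/setP => x; rewrite -!nth_inword e. Qed.

Lemma ptswapE k i (x : 'I_k) : (0 < i < k)%N -> val (ptswap i x) = swapn i x.
Proof.
move=> ik; rewrite /ptswap val_insubd; case: ifP => // /negP[].
by rewrite /swapn; have := ltn_ord x; do 2?case: eqP; lia.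
Qed.

Lemma swapnK i : (0 < i)%N -> involutive (swapn i).
Proof. by move=> i0 n; rewrite /swapn; repeat case: eqP; lia. Qed.

Lemma inword_swap k i (B : {set 'I_k}) w1 b1 b2 w2 :
  (size w1).+1 = i -> inword B = w1 ++ [:: b1, b2 & w2] ->
  inword (ptswap i @: B) = w1 ++ [:: b2, b1 & w2].
Proof.
move=> si e; have sB := size_inword _ B.
have ik : (0 < i < k)%N by rewrite -sB e size_cat /=; lia.
have pK : involutive (@ptswap k i).
  by move=> x; apply: val_inj; rewrite !ptswapE // swapnK //; case/andP: ik.
apply: (@eq_from_nth _ false) => [|j]; rewrite size_inword.
  by rewrite -sB e !size_cat.
move=> jk; rewrite -[j]/(val (Ordinal jk)) nth_inword.
rewrite -[Ordinal jk in LHS]pK mem_imset; last exact: inv_inj.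
rewrite -nth_inword ptswapE // e /= /swapn !nth_cat.
have [->|ne1] := eqVneq j i.-1.
  by rewrite -si /= ltnn subnn ltnNge leqnSn /= subSnn.
have [->|ne2] := eqVneq j i.
  by rewrite -si /= ltnn subnn ltnNge leqnSn /= subSnn.
case: ltnP => // sj; case: (_ - _)%N (subnKC sj) => [|[|n]] //=; lia.
Qed.

Lemma inword_split k x n (B : {set 'I_k}) : (x + n.+2 = k)%N ->
  exists w1 b1 b2 w2, [/\ size w1 = x, inword B = w1 ++ [:: b1, b2 & w2] &
                          inword (ptswap x.+1 @: B) = w1 ++ [:: b2, b1 & w2]].
Proof.
move=> xk; have sB := size_inword _ B; have e := cat_take_drop x (inword B).
have st : size (take x (inword B)) = x by rewrite size_takel //; lia.
have: size (drop x (inword B)) = n.+2 by rewrite size_drop; lia.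
case: (drop _ _) e => [|b1 [|b2 w2]] // e _.
exists (take x (inword B)), b1, b2, w2; split=> //.
by apply: inword_swap; rewrite ?st.
Qed.

Definition word_fun k (psi : seq bool -> F) : pmod F k := [ffun B => psi (inword B)].

Lemma tact_word_fun k x y : (size x + (size y).+2 = k)%N ->
  tact (size x).+1 (word_fun k (fun w => (w == x ++ [:: true, false & y])%:R)) =
  word_fun k (fun w => (w == x ++ [:: false, true & y])%:R).
Proof.
move=> sk; apply/ffunP => B; rewrite !ffunE.
have [w1 [b1 [b2 [w2 [sw1 -> ->]]]]] := inword_split _ _ _ B sk.
rewrite !eqseq_cat // !eqseq_cons.
by case: b1 b2 => [] [].
Qed.

Lemma sact_word_fun k x y : (size x + (size y).+2 = k)%N ->
  sact (size x).+1 (word_fun k (cup_coef F [::] (x ++ [:: true, false & y]))) =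
  word_fun k (cup_coef F [::] (x ++ [:: false, true & y])).
Proof.
move=> sk; apply/ffunP => B; rewrite !ffunE.
have [w1 [b1 [b2 [w2 [sw1 -> ->]]]]] := inword_split _ _ _ B sk.
by rewrite cup_coef_swap.
Qed.

Lemma mgenE f g :
  mgen F f g = word_fun (f + g) (fun w => (w == nseq f true ++ nseq g false)%:R).
Proof.
have e : inword [set x : 'I_(f + g) | (val x < f)%N] = nseq f true ++ nseq g false.
  apply: (@eq_from_nth _ false); rewrite size_inword ?size_cat ?size_nseq // => j jk.
  rewrite -[j in LHS]/(val (Ordinal jk)) nth_inword inE /= nth_cat size_nseq !nth_nseq.
  by case: ltnP => // _; case: ifP.
apply/ffunP => B; rewrite !ffunE -e (inj_eq (inword_inj _)).
by case: eqP.
Qed.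

Lemma cup_coef_nseq_false st g w : size w = g ->
  cup_coef F st (nseq g false) w = (~~ has id st && (w == nseq g false))%:R.
Proof.
elim: g st w => [|g IHg] st [|b w] //= => [_|[sw]]; first by rewrite eqxx andbT.
by rewrite IHg //= eqseq_cons; case: b; rewrite ?andbF.
Qed.

(** The word U...UD...D has no chord, so its singlet product is the generator; this starts the
    action of the [s_i]. *)
Lemma cup_coef_nseq f g w : size w = (f + g)%N ->
  cup_coef F [::] (nseq f true ++ nseq g false) w = (w == nseq f true ++ nseq g false)%:R.
Proof.
elim: f w => [|f IHf] w; first by move=> sw; rewrite cup_coef_nseq_false.
case: w => [|b w] // [sw]; rewrite /= IHf // eqseq_cons.
by case: b; rewrite ?mulr0n ?subr0 ?mul1r ?mul0r.
Qed.

Lemma tw_act_rows_gens f g l : size l = g -> path geq f l ->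
  tw_act (rows_gens f l) (mgen F f g) = word_fun (f + g) (fun w => (w == rows_word f l)%:R).
Proof.
move=> <- pl; rewrite mgenE; have := foldr_rows_gens _ (@tact F (f + size l))
  (fun la => word_fun _ (fun w => (w == la)%:R)) _ (tact_word_fun _) _ _ [::] pl.
by rewrite !cats0; apply; rewrite addn0.
Qed.

Lemma sw_act_rows_gens f g l : size l = g -> path geq f l ->
  sw_act (rows_gens f l) (mgen F f g) = word_fun (f + g) (cup_coef F [::] (rows_word f l)).
Proof.
move=> <- pl; rewrite mgenE.
have -> : word_fun (f + size l) (fun w => (w == nseq f true ++ nseq (size l) false)%:R) =
    word_fun (f + size l) (cup_coef F [::] (nseq f true ++ nseq (size l) false)).
  by apply/ffunP => B; rewrite !ffunE cup_coef_nseq // size_inword.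
have := foldr_rows_gens _ (@sact F (f + size l))
  (fun la => word_fun _ (cup_coef F [::] la)) _ (sact_word_fun _) _ _ [::] pl.
by rewrite !cats0; apply; rewrite addn0.
Qed.

End Module.

(** * Labellings layer by layer *)

Lemma labelings_uniq st d la mu : uniq (labelings st d la mu).
Proof.
elim: la st d mu => [|[] la IHla] st d [|b mu] /=; try by case: ifP.
  by case: leqP => // _; rewrite map_inj_uniq // => ? ? [].
case: leqP => // _; apply: allpairs_uniq_dep => //; first exact: iota_uniq.
by move=> [x1 y1] [x2 y2] _ _ /= [-> ->].
Qed.

(* [bs] marks the steps of the word [la] crossed by a tile of a fixed layer, and [r]
   is the depth below the start of the current tile: every maximal marked run has
   to be a balanced Dyck word. *)
Fixpoint dyck_runs (r : nat) (la bs : seq bool) : bool :=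
  match la, bs with
  | a :: la', true :: bs' =>
      if a then (0 < r) && dyck_runs r.-1 la' bs' else dyck_runs r.+1 la' bs'
  | _ :: la', false :: bs' => (r == 0) && dyck_runs 0 la' bs'
  | _, _ => r == 0
  end.

(** Inside a run D deepens and U rises; an unmarked step has depth 0 on both sides. *)
Definition depth_step (a b : bool) (x y : nat) : bool :=
  if b then (if a then x == y.+1 else y == x.+1) else (x == 0) && (y == 0).

(** A depth function indexed by columns is the form that can be compared with heights of nodes. *)
Lemma dyck_runsP r0 la bs : size bs = size la ->
  dyck_runs r0 la bs <->
  exists r : nat -> nat, [/\ r 0 = r0, r (size la) = 0 &
    forall c, c < size la -> depth_step (nth false la c) (nth false bs c) (r c) (r c.+1)].
Proof.
elim: la r0 bs => [|a la IHla] r0 [|b bs] //= => [_|[sz]].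
  by split=> [/eqP-> | [r [<- -> _]] //]; exists (fun _ => 0).
have step r1 : dyck_runs r1 la bs -> depth_step a b r0 r1 ->
    exists r : nat -> nat, [/\ r 0 = r0, r (size la).+1 = 0 & forall c, c < (size la).+1 ->
      depth_step (nth false (a :: la) c) (nth false (b :: bs) c) (r c) (r c.+1)].
  move=> /(IHla _ _ sz)[r [r01 rk rS]] st; exists (fun c => if c is c'.+1 then r c' else r0).
  by split=> // -[|c] /= ck; [rewrite r01 | apply: rS].
split=> [|[r [r0E rk rS]]].
  case: b {IHla} step => step; last by case/andP=> /eqP r00 H; apply: (step _ H); rewrite r00.
  case: a step => step; last by move=> H; apply: (step _ H) => /=.
  by case/andP=> r00 H; apply: (step _ H); rewrite /depth_step prednK.
have H r1 : r 1 = r1 -> dyck_runs r1 la bs.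
  by move=> rE; apply/IHla => //; exists (r \o succn); split=> // c ck; apply: (rS c.+1).
have := rS 0 isT; rewrite /= r0E /depth_step.
case: b {step rS} => [|/andP[-> /eqP/H->]] //.
by case: a => [/eqP-> /=|/eqP/H]; [apply: H | ].
Qed.

Lemma count_gt_eq0 j st : sorted geq st -> (count (ltn j) st == 0) = (head 0 st <= j).
Proof.
case: st => [|x st] //= p; case: ltnP => //= xj.
rewrite add0n eqn0Ngt -has_count; apply/hasPn => y yst /=; rewrite -leqNgt.
by have /allP/(_ y yst) /= := order_path_min (rev_trans leq_trans) p => /leq_trans; apply.
Qed.

Lemma count_gt_behead j st : sorted geq st ->
  count (ltn j) (behead st) = (count (ltn j) st).-1.
Proof.
case: st => [|x st] //= p; case: ltnP => //= xj.
by have := count_gt_eq0 j (x :: st) p; rewrite /= ltnNge xj add0n => /eqP->.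
Qed.

Lemma sorted_behead st : sorted geq st -> sorted geq (behead st).
Proof. by case: st => //= x st; apply: path_sorted. Qed.

(** Layer [j] consists of the steps with label above [j]; it begins at the depth given by the open
    labels above [j]. Each label is bounded by the distance of the two paths at both ends of its
    step. *)
Definition label_spec (st : seq nat) d (la mu : seq bool) (n : seq nat) : Prop :=
  [/\ size n = size la, d + count id la = count id mu,
      forall c, c < size la ->
        nth 0 n c + count id (take c mu) <= d + count id (take c la) /\
        nth 0 n c + count id (take c.+1 mu) <= d + count id (take c.+1 la) &
      forall j, dyck_runs (count (ltn j) st) la (map (ltn j) n)].

Lemma label_spec_true st d la b mu n : sorted geq st ->
  label_spec st d (true :: la) (b :: mu) n <->
  head 0 st <= d /\ exists2 n', n = head 0 st :: n' &
    label_spec (behead st) (d + ~~ b) la mu n'.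
Proof.
move=> sst; split=> [[] | [hd [n' -> [sz en bd dk]]]].
  case: n => //= x n [sz] en bd dk.
  (* Layer [head 0 st] rules out a larger [x], since no open D is left to close; layer [x] leaves
     the U unmarked and rules out a smaller one. *)
  have xE : x = head 0 st.
    apply/eqP; rewrite eqn_leq leqNgt -count_gt_eq0 //; apply/andP; split.
      apply/negP => lt; have := dk (head 0 st); rewrite lt => /andP[].
      by rewrite lt0n count_gt_eq0 ?leqnn.
    by have := dk x; rewrite ltnn => /andP[].
  have [b0 _] := bd 0 isT; rewrite /= !addn0 in b0.
  rewrite -xE; split=> //; exists n => //; split=> // [|c ck|j]; first by case: b en {bd}; lia.
    by have := bd c.+1 ck; case: b {bd en} => /=; lia.
  rewrite count_gt_behead //; have := dk j.
  case: ltnP => [_ /andP[]//|xj /andP[/eqP->]//].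
split=> //= [|||j]; first by rewrite sz.
- by case: b en {bd}; lia.
- case=> [|c] ck /=; first by case: b {en bd}; rewrite !take0 /=; lia.
  by have := bd c ck; case: b {bd en} => /=; lia.
have := dk j; rewrite count_gt_behead //; case: ltnP => [lt ->| le].
  by rewrite lt0n count_gt_eq0 // -ltnNge lt.
by rewrite count_gt_eq0 // le /=; move: le; rewrite -count_gt_eq0 // => /eqP->.
Qed.

Lemma label_spec_false st d la b mu n : sorted geq st ->
  label_spec st d (false :: la) (b :: mu) n <->
  b <= d /\ exists x n', [/\ n = x :: n', head 0 st <= x <= d - b &
    label_spec (x :: st) (d - b) la mu n'].
Proof.
move=> sst; split=> [[] | [hd [x [n' [-> /andP[hx xd] [sz en bd dk]]]]]].
  case: n => //= x n [sz] en bd dk.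
  have [_ b0] := bd 0 isT; rewrite /= !take0 /= !addn0 in b0.
  (* In layer [x] this D is unmarked, so no open label exceeds [x]: labels increase inwards. *)
  have hx : head 0 st <= x.
    rewrite -count_gt_eq0 //; by have := dk x; rewrite ltnn => /andP[].
  split; first by lia.
  exists x, n; split=> //; first by lia.
  split=> // [|c ck|j]; first by lia.
    by have := bd c.+1 ck; rewrite /=; lia.
  have := dk j; rewrite /=; case: ltnP => [_ | xj /andP[/eqP-> ]] //.
split=> //= [|||j]; first by rewrite sz.
- by lia.
- case=> [|c] ck /=; first by rewrite !take0 /=; lia.
  by have := bd c ck; rewrite /=; lia.
have := dk j; rewrite /=; case: ltnP => // xj.
have /eqP -> : count (ltn j) st == 0 by rewrite count_gt_eq0 // (leq_trans hx).
by [].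
Qed.

Lemma labelingsP st d la mu n : sorted geq st -> size la = size mu ->
  n \in labelings st d la mu <-> label_spec st d la mu n.
Proof.
elim: la st d mu n => [|a la IHla] st d [|b mu] n sst //= => [_|[sz]].
  (* Once the words are exhausted, layer 0 alone says that all open labels vanish; ['I_1] makes this
     boolean. *)
  have st0 : all (pred1 0) st = [forall j : 'I_1, count (ltn j) st == 0].
    apply/idP/forallP => [/all_pred1P-> j | /(_ ord0)].
      by rewrite count_nseq.
    by rewrite eqn0Ngt -has_count -all_predC; apply: sub_all => -[].
  split=> [|[/size0nil-> + _ dk]].
    case: ifP => // /andP[/eqP-> s0]; rewrite inE => /eqP->; split=> // j.
    by move/all_pred1P: s0 => ->; rewrite /= count_nseq.
  rewrite addn0 => -> /=; rewrite st0.
  by have -> : [forall j : 'I_1, count (ltn j) st == 0] by apply/forallP => j; apply: dk.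
case: a.
  rewrite label_spec_true //; split.
    case: leqP => // hd /mapP[n' n'L ->]; split=> //; exists n' => //.
    by apply/IHla => //; apply: sorted_behead.
  case=> -> [n' -> n'L]; apply/map_f/IHla => //; exact: sorted_behead.
rewrite label_spec_false //; split.
  case: leqP => // bd /allpairsPdep[x [n' [+ n'L ->]]].
  rewrite mem_index_iota ltnS => hx; split=> //; exists x, n'; split=> //.
  apply/IHla => //=; case: st sst hx {n'L} => //= y st -> /andP[-> _] //.
case=> -> [x [n' [-> hx n'L]]]; apply/allpairsPdep; exists x, n'; split=> //.
  by rewrite mem_index_iota ltnS.
apply/IHla => //=; case: st sst hx {n'L} => //= y st -> /andP[-> _] //.
Qed.

(** * Tiles and tilings *)

Section Tiles.
Context {f g : nat}.
Implicit Types (x y z : node f g) (T : {set node f g}).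

(** Nodes are handled by column and second coordinate: every tile step goes one column right, NE
    raising the second coordinate and SE keeping it. *)
Lemma node_eq x y : colN x = colN y -> x.2 = y.2 :> nat -> x = y.
Proof.
case: x y => [[x1 lt1] x2] [[y1 lt2] y2]; rewrite /colN /= => + /val_inj e2.
by rewrite e2 => e1; congr pair; apply: val_inj => /=; move: lt1 lt2; lia.
Qed.

Lemma colN_le x : colN x <= f + g.
Proof. by rewrite /colN; have := ltn_ord x.2; lia. Qed.

Lemma height_colN x : height x + colN x = x.2 + x.2 + g.
Proof. by rewrite /height /colN; have := ltn_ord x.1; lia. Qed.

Lemma tstepE x y :
  tstep x y =
  (colN y == (colN x).+1) && ((y.2 == x.2 :> nat) || (y.2 == x.2.+1 :> nat)).
Proof.
case: x y => [[x1 lt1] [x2 ?]] [[y1 lt2] [y2 ?]].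
by rewrite /tstep /colN /=; move: lt1 lt2; lia.
Qed.

Lemma tstartP T : T != set0 ->
  tstart T \in T /\ (forall z, z \in T -> colN (tstart T) <= colN z).
Proof.
case/set0Pn => x0 x0T; rewrite /tstart; case: pickP => /= [x /andP[xT /forall_inP] | none].
  by move=> H; split=> // z zT; apply: H.
have [x xT xmin] := arg_minnP (@colN f g) x0T.
by case/andP: (none x); split=> //; apply/forall_inP => z zT; apply: xmin.
Qed.

Lemma tendP T : T != set0 ->
  tend T \in T /\ (forall z, z \in T -> colN z <= colN (tend T)).
Proof.
case/set0Pn => x0 x0T; rewrite /tend; case: pickP => /= [x /andP[xT /forall_inP] | none].
  by move=> H; split=> // z zT; apply: H.
have [x xT xmin] := arg_maxnP (@colN f g) x0T.
by case/andP: (none x); split=> //; apply/forall_inP => z zT; apply: xmin.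
Qed.

Lemma tile_seq T : is_tile T -> exists s : seq (node f g), exists x0, exists a,
  [/\ T =i s, sorted (@tstep f g) s & forall i, i < size s -> colN (nth x0 s i) = a + i].
Proof.
case/andP=> /set0Pn[x0 _] /existsP[s /andP[/eqP e ss]].
exists s, x0, (colN (nth x0 s 0)); split=> // [x|]; first by rewrite {1}e inE.
elim=> [|i IHi] si; first by rewrite addn0.
have /sortedP := ss => /(_ x0 i si); rewrite tstepE => /andP[/eqP-> _].
by rewrite IHi ?addnS // ltnW.
Qed.

Section InTile.
Variable T : {set node f g}.
Hypothesis tileT : is_tile T.

Lemma tile_neq0 : T != set0. Proof. by case/andP: tileT. Qed.

Lemma tile_col_inj x y : x \in T -> y \in T -> colN x = colN y -> x = y.
Proof.
have [s [x0 [a [Ts ss cs]]]] := tile_seq _ tileT; rewrite !Ts.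
move=> /(nthP x0)[i si <-] /(nthP x0)[j sj <-].
by rewrite !cs // => /addnI->.
Qed.

Lemma tile_col_between x y c : x \in T -> y \in T -> colN x <= c <= colN y ->
  exists2 z, z \in T & colN z = c.
Proof.
have [s [x0 [a [Ts ss cs]]]] := tile_seq _ tileT; rewrite !Ts.
move=> /(nthP x0)[i si <-] /(nthP x0)[j sj <-]; rewrite !cs // => ac.
have ca : c - a < size s by apply: leq_ltn_trans sj; lia.
by exists (nth x0 s (c - a)); rewrite ?Ts ?mem_nth // cs //; lia.
Qed.

Lemma tile_step x y : x \in T -> y \in T -> colN y = (colN x).+1 -> tstep x y.
Proof.
have [s [x0 [a [Ts ss cs]]]] := tile_seq _ tileT; rewrite !Ts.
move=> /(nthP x0)[i si <-] /(nthP x0)[j sj <-]; rewrite !cs // -addnS => /addnI ji.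
by rewrite ji in sj *; have /sortedP := ss; apply.
Qed.

End InTile.

Lemma is_tile_intro T (h : nat -> node f g) a n :
    (forall c, a <= c <= a + n -> colN (h c) = c) ->
    (forall c, a <= c < a + n -> tstep (h c) (h c.+1)) ->
    (forall x, reflect (exists2 c, a <= c <= a + n & x = h c) (x \in T)) ->
  is_tile T.
Proof.
move=> hcol hstep hT; pose s := [seq h c | c <- iota a n.+1].
have Ts : T =i s.
  move=> x; apply/hT/mapP => -[c]; rewrite ?mem_iota => cP ->; exists c => //.
    by rewrite mem_iota; lia.
  by lia.
have us : uniq s.
  rewrite map_inj_in_uniq ?iota_uniq // => c c'; rewrite !mem_iota => cP cP' e.
  by move: (congr1 (@colN f g) e); rewrite !hcol //; lia.
have sz : size s == #|T| by rewrite (eq_card Ts) (card_uniqP us).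
apply/andP; split; first by apply/set0Pn; exists (h a); apply/hT; exists a => //; lia.
apply/existsP; exists (Tuple sz); apply/andP; split.
  by apply/eqP/setP => x; rewrite inE; apply: Ts.
apply/(sortedP (h 0)) => i; rewrite /= size_map size_iota => ip.
by rewrite !(nth_map 0) ?size_iota ?nth_iota ?addnS ?hstep //; lia.
Qed.

End Tiles.

(* Column [c] of the skew diagram [D] consists of the nodes with second coordinate
   in (v c, u c], where u and v count the U's in prefixes of the words of the outer
   and inner partition; layers are counted from the top. *)
Section Tilings.
Variables (f g : nat) (u v : nat -> nat) (W : nat -> bool) (D : {set node f g}).
Local Notation k := (f + g).
Hypothesis uS : forall c, c < k -> u c.+1 = u c + W c.
Hypothesis u_f : forall c, c <= k -> u c <= f.
Hypothesis u_c : forall c, c <= k -> u c <= c.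
Hypothesis v_g : forall c, c <= k -> c <= v c + g.
Hypothesis uvk : u k = v k.
Hypothesis vu : forall c, c <= k -> v c <= u c.
Hypothesis memD : forall x : node f g, (x \in D) = (v (colN x) < x.2 <= u (colN x)).
Implicit Types (x y z : node f g) (P : {set {set node f g}}).

Definition layer x : nat := u (colN x) - x.2.
(** The values given to [inord] are in range once column [c] has more than [j] nodes, by
    [at_layerP]. *)
Definition at_layer j c : node f g := (inord (u c - j + g - c), inord (u c - j)).

Lemma at_layerP j c : c <= k -> v c + j < u c ->
  [/\ colN (at_layer j c) = c, (at_layer j c).2 = u c - j :> nat,
      at_layer j c \in D & layer (at_layer j c) = j].
Proof.
move=> ck jd; have uf := u_f c ck; have uc := u_c c ck; have vg := v_g c ck.
have e2 : (at_layer j c).2 = u c - j :> nat by rewrite /= inordK //; lia.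
have ec : colN (at_layer j c) = c by rewrite /colN e2 /= inordK; lia.
by split=> //; rewrite ?memD /layer ec e2; lia.
Qed.

Lemma at_layer_layer x : x \in D -> x = at_layer (layer x) (colN x).
Proof.
rewrite memD => xD; have [|ec e2 _ _] := at_layerP (layer x) (colN x) (colN_le x).
  by rewrite /layer; lia.
by apply: node_eq; rewrite ?ec ?e2 // /layer; lia.
Qed.

Lemma layer_lt x : x \in D -> v (colN x) + layer x < u (colN x).
Proof. by rewrite memD /layer; lia. Qed.

Lemma colN_lt x : x \in D -> colN x < k.
Proof.
move=> xD; have := layer_lt x xD; have := colN_le x; rewrite leq_eqVlt.
by case: eqP => [->|] //; rewrite uvk; lia.
Qed.

(** Each layer is a translate of the rim, whose steps are NE or SE. *)
Lemma tstep_at_layer j c : c < k -> v c + j < u c -> v c.+1 + j < u c.+1 ->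
  tstep (at_layer j c) (at_layer j c.+1).
Proof.
move=> ck j1 j2; have [e1 e2 _ _] := at_layerP j c (ltnW ck) j1.
have [e1' e2' _ _] := at_layerP j c.+1 ck j2.
by rewrite tstepE e1 e1' eqxx e2 e2'; have := uS c ck; lia.
Qed.

(** The local conditions of [label_spec] for an empty stack and [d = 0], expressed by [u], [v] and
    [W]. *)
Definition valid_labeling (n : seq nat) : Prop :=
  [/\ size n = k,
      forall c, c < k -> nth 0 n c + v c <= u c /\ nth 0 n c + v c.+1 <= u c.+1 &
      forall j, exists r, [/\ r 0 = 0, r k = 0 &
        forall c, c < k -> depth_step (W c) (j < nth 0 n c) (r c) (r c.+1)]].

(* Two nodes of one layer lie in the same tile iff no step between them has a label
   at most that layer, i.e. iff the number of such steps to their left agrees. *)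
Definition run_key n x := (layer x, count (geq (layer x)) (take (colN x) n)).

Definition tiling_of n := preim_partition (run_key n) D.

Definition tiling_ok P := dyck_tiling P D && cover_incl P D.

Lemma count_take_eq (p : pred nat) n a b : a <= b <= size n ->
  count p (take a n) = count p (take b n) <->
  (forall i, a <= i < b -> ~~ p (nth 0 n i)).
Proof.
case/andP=> ab bn; rewrite -(subnKC ab) takeD count_cat.
have sz : size (take (b - a) (drop a n)) = b - a.
  by rewrite size_takel // size_drop leq_sub2r.
split=> [e i /andP[ai ib] | H].
  have /hasPn : ~~ has p (take (b - a) (drop a n)) by rewrite has_count; lia.
  rewrite subnKC // in ib; move/(_ (nth 0 n i)); apply.
  by apply/(nthP 0); exists (i - a); rewrite ?sz ?nth_take ?nth_drop ?subnKC //; lia.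
suff : ~~ has p (take (b - a) (drop a n)) by rewrite has_count; lia.
apply/hasPn => _ /(nthP 0)[i ip <-]; rewrite sz in ip.
by rewrite nth_take // nth_drop H //; lia.
Qed.

Lemma run_keyP n x y : size n = k -> colN x <= colN y ->
  run_key n x = run_key n y <->
  layer x = layer y /\ forall i, colN x <= i < colN y -> layer x < nth 0 n i.
Proof.
move=> sn xy; have yn : colN x <= colN y <= size n by rewrite xy sn colN_le.
split=> [[e]|[e H]].
  by rewrite -e => /(count_take_eq _ _ _ _ yn) H; split=> // i /H; rewrite /= -ltnNge.
congr pair => //; rewrite -e; apply/count_take_eq => // i /H.
by rewrite /= -ltnNge.
Qed.

Lemma pblock_tiling_of n x y : x \in D -> y \in D ->
  (y \in pblock (tiling_of n) x) = (run_key n x == run_key n y).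
Proof.
move=> xD yD; rewrite pblock_equivalence_partition // => a b c _ _ _.
by split=> // /eqP->.
Qed.

Lemma partition_pblock P x : partition P D -> x \in D ->
  pblock P x \in P /\ x \in pblock P x.
Proof.
move=> pP xD; have xc : x \in cover P by rewrite (cover_partition pP).
by rewrite pblock_mem // mem_pblock.
Qed.

Lemma partition_pblockD P x y : partition P D -> y \in pblock P x -> y \in D.
Proof.
move=> pP yx; have : y \in pblock P y by rewrite (same_pblock (partition_trivIset pP) yx).
by rewrite mem_pblock (cover_partition pP).
Qed.

Lemma cover_inclP P : cover_incl P D <->
  forall x y, colN y = colN x -> y.2 = x.2.+1 :> nat -> x \in D -> y \in D ->
    colN (tstart (pblock P y)) <= colN (tstart (pblock P x)) /\
    colN (tend (pblock P x)) <= colN (tend (pblock P y)).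
Proof.
split=> [/forallP H x y cxy y2 xD yD | H].
  have /forallP/(_ y)/implyP := H x.
  suff -> : [&& val y.1 == (val x.1).+1, val y.2 == (val x.2).+1, x \in D & y \in D].
    by move/(_ isT)/andP.
  rewrite xD yD -[val y.2]/(nat_of_ord y.2) y2 eqxx !andbT; apply/eqP.
  move: cxy (ltn_ord y.1) (ltn_ord x.1); rewrite /colN y2 => + + + /=.
  by move: xD; rewrite memD; lia.
apply/forallP => x; apply/forallP => y; apply/implyP => /and4P[/eqP y1 /eqP y2 xD yD].
by apply/andP; apply: H => //; rewrite /colN /= y1 y2 addSn subSS.
Qed.

(** * From chord labellings to tilings *)

Section OfLabeling.
Variable n : seq nat.
Hypothesis nP : valid_labeling n.

Let sn : size n = k. Proof. by case: nP. Qed.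
Let parP : partition (tiling_of n) D. Proof. exact: preim_partitionP. Qed.

Lemma mem_pblockP x y : x \in D -> y \in D -> colN x <= colN y ->
  y \in pblock (tiling_of n) x <->
  layer x = layer y /\ forall i, colN x <= i < colN y -> layer x < nth 0 n i.
Proof.
move=> xD yD xy; rewrite pblock_tiling_of // -(run_keyP n) //.
by split=> /eqP.
Qed.

Lemma labeling_layer j c : c < k -> j < nth 0 n c ->
  v c + j < u c /\ v c.+1 + j < u c.+1.
Proof. by case: nP => _ H _ /H; lia. Qed.

Lemma run_layer j x c : layer x = j -> x \in D -> colN x <= c <= k ->
  (forall i, colN x <= i < c -> j < nth 0 n i) -> v c + j < u c.
Proof.
move=> <- xD; elim: c => [|c IHc] xc H.
  by have := layer_lt x xD; have -> : colN x = 0 by lia.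
have [<-|cx] := eqVneq (colN x) c.+1; first exact: layer_lt.
by have [||_ //] := labeling_layer (layer x) c; [lia | apply: H; lia].
Qed.

Section Block.
Variable x : node f g.
Hypothesis xD : x \in D.
Let T := pblock (tiling_of n) x.
Let j := layer x.

Let TD z : z \in T -> z \in D. Proof. exact: partition_pblockD. Qed.

Let xT : x \in T. Proof. by have [] := partition_pblock _ x parP xD. Qed.

Lemma block_neq0 : T != set0. Proof. by apply/set0Pn; exists x. Qed.

Let a := colN (tstart T).
Let b := colN (tend T).
Let sT : tstart T \in T. Proof. by have [] := tstartP T block_neq0. Qed.
Let eT : tend T \in T. Proof. by have [] := tendP T block_neq0. Qed.
Let Tcol z : z \in T -> a <= colN z <= b.
Proof.
move=> zT; have [_ ->] := tstartP T block_neq0 => //.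
by have [_ ->] := tendP T block_neq0.
Qed.

Let ab : a <= b. Proof. by case/andP: (Tcol _ sT). Qed.
Let bk : b < k. Proof. by apply: colN_lt; apply: TD. Qed.

Let blockE z : z \in T -> T = pblock (tiling_of n) z.
Proof. by move=> zT; rewrite (same_pblock (partition_trivIset parP) zT). Qed.

Let block_key z : z \in T -> run_key n x = run_key n z.
Proof. by move=> zT; apply/eqP; rewrite -pblock_tiling_of ?TD. Qed.

Let block_layer z : z \in T -> layer z = j.
Proof. by move/block_key => -[]. Qed.

Lemma block_run i : a <= i < b -> j < nth 0 n i.
Proof.
move=> iab; have key : run_key n (tstart T) = run_key n (tend T).
  by rewrite -!block_key.
by have /(run_keyP _ _ _ sn ab) [_ /(_ i iab)] := key; rewrite block_layer.
Qed.

Let depth_ok c : a <= c <= b -> v c + j < u c.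
Proof.
move=> cab; apply: (run_layer j (tstart T)) => //; [exact: block_layer | exact: TD | |].
  by have := bk; rewrite -/a; lia.
by move=> i iab; apply: block_run; lia.
Qed.

Let block_at c : a <= c <= b -> at_layer j c \in T.
Proof.
move=> cab; have [|e1 e2 cD e3] := at_layerP j c _ (depth_ok c cab).
  by have := bk; lia.
rewrite (blockE _ sT); apply/(mem_pblockP (tstart T)) => //; first exact: TD.
  by rewrite e1; case/andP: cab.
rewrite e1 e3 (block_layer _ sT); split=> // i iab.
by apply: block_run; lia.
Qed.

Lemma block_mem z : reflect (exists2 c, a <= c <= b & z = at_layer j c) (z \in T).
Proof.
apply: (iffP idP) => [zT | [c cab ->]]; last exact: block_at.
exists (colN z); first exact: Tcol.
by rewrite -(block_layer z zT); apply/at_layer_layer/TD.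
Qed.

(** Runs are maximal: were the label before the start above [j], the node of layer [j] one column to
    the left would share the key of the block. *)
Lemma block_start : a = 0 \/ exists2 c, a = c.+1 & nth 0 n c <= j.
Proof.
case aE : a => [|c]; [by left | right; exists c => //].
rewrite leqNgt; apply/negP => jn; have ck : c < k by have := bk; have := ab; lia.
have [d1 d2] := labeling_layer j c ck jn.
have [e1 e2 cD e3] := at_layerP j c (ltnW ck) d1.
suff : at_layer j c \in T by move/Tcol; rewrite e1 aE ltnn.
have cs : colN (at_layer j c) <= colN (tstart T) by rewrite e1 -/a aE.
rewrite pblock_tiling_of // (block_key _ sT) eq_sym.
apply/eqP/(run_keyP _ _ _ sn cs); rewrite e3 e1 (block_layer _ sT) -/a aE.
by split=> // i ic; have -> : i = c by lia.
Qed.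

Lemma block_end : nth 0 n b <= j.
Proof.
rewrite leqNgt; apply/negP => jn; have [d1 d2] := labeling_layer j b bk jn.
have [e1 e2 cD e3] := at_layerP j b.+1 bk d2.
suff : at_layer j b.+1 \in T by move/Tcol; rewrite e1 ltnn andbF.
have cs : colN (tend T) <= colN (at_layer j b.+1) by rewrite e1 -/b.
rewrite pblock_tiling_of // (block_key _ eT).
apply/eqP/(run_keyP _ _ _ sn cs); rewrite e3 e1 (block_layer _ eT) -/b.
by split=> // i ic; have -> : i = b by lia.
Qed.

Lemma block_tile : is_tile T.
Proof.
apply: (@is_tile_intro _ _ T (at_layer j) a (b - a)); rewrite ?subnKC //.
- move=> c cab; have [|//] := at_layerP j c _ (depth_ok c cab); have := bk; lia.
- move=> c cab; apply: tstep_at_layer; [have := bk; lia | apply: depth_ok; lia ..].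
exact: block_mem.
Qed.

(** The depth in layer [j] is the drop in height below the start of the block; it is nonnegative and
    vanishes at both ends. *)
Lemma block_dyck : is_dyck T.
Proof.
have [_ _ /(_ j)[r [r0 rk rS]]] := nP.
have hE c : a <= c <= b -> height (at_layer j c) + c + j + j = u c + u c + g.
  move=> cab; have := height_colN (at_layer j c); have d := depth_ok c cab.
  have [|-> -> _ _] := at_layerP j c _ d; first by have := bk; lia.
  lia.
have ra : r a = 0.
  case: block_start => [->//|[c ac nc]]; rewrite ac.
  have ck : c < k by have := bk; have := ab; lia.
  by have := rS c ck; rewrite /depth_step ltnNge nc => /andP[_ /eqP].
have rb : r b = 0.
  by have := rS b bk; rewrite /depth_step ltnNge block_end => /andP[/eqP].
have startE : tstart T = at_layer j a.
  by rewrite -(block_layer _ sT); apply/at_layer_layer/TD.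
have endE : tend T = at_layer j b.
  by rewrite -(block_layer _ eT); apply/at_layer_layer/TD.
have hr c : a <= c <= b -> height (at_layer j c) + r c = height (tstart T).
  elim: c => [|c IHc] cab; first by have a0 : a = 0; [lia | rewrite startE a0 r0 addn0].
  have [<-|ac] := eqVneq a c.+1; first by rewrite startE ra addn0.
  have cab' : a <= c <= b by lia.
  have ck : c < k by have := bk; lia.
  rewrite -(IHc cab'); have := hE c cab'; have := hE c.+1 cab; rewrite (uS c ck).
  have := rS c ck; rewrite /depth_step block_run; last by lia.
  by case: (W c) => /eqP->; lia.
have hmax : \max_(z in T) height z = height (tstart T).
  apply/eqP; rewrite eqn_leq leq_bigmax_cond // andbT; apply/bigmax_leqP => z.
  by case/block_mem => c cab ->; rewrite -(hr c cab) leq_addr.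
apply/and3P; split; [exact: block_tile | by rewrite hmax | rewrite hmax].
by rewrite endE -(hr b) ?rb ?addn0 // ab leqnn.
Qed.

End Block.

Lemma tiling_of_ok : tiling_ok (tiling_of n).
Proof.
have block T : T \in tiling_of n -> exists2 x, x \in D & T = pblock (tiling_of n) x.
  move=> TP; have /set0Pn[x xT] : T != set0.
    by apply: contraTneq TP => ->; case/and3P: parP.
  have e := def_pblock (partition_trivIset parP) TP xT; exists x => //.
  by rewrite -e in xT; apply: partition_pblockD xT.
apply/andP; split.
  by apply/andP; split=> //; apply/forall_inP => T /block[x xD ->]; apply: block_dyck.
apply/cover_inclP => x y cxy y2 xD yD.
have lxy : layer x = (layer y).+1 by move: (yD); rewrite memD /layer cxy y2; lia.
(* A label above the layer of [x] is also above the layer of [y], so the tile of [x] moved up by one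
   stays inside the tile of [y]. *)
have sub z : z \in pblock (tiling_of n) x ->
    exists2 z', z' \in pblock (tiling_of n) y & colN z' = colN z.
  move=> zx; have zD := partition_pblockD _ _ _ parP zx.
  move: zx; rewrite pblock_tiling_of // => /eqP key.
  have lz : layer z = (layer y).+1 by rewrite -lxy; case: key.
  have [|e1 _ z'D e3] := at_layerP (layer y) (colN z) (colN_le z).
    by have := layer_lt z zD; rewrite lz; lia.
  exists (at_layer (layer y) (colN z)) => //; rewrite pblock_tiling_of //.
  have [xz|/ltnW zx] := leqP (colN x) (colN z).
    have [_ H] := (run_keyP _ _ _ sn xz).1 key.
    apply/eqP/run_keyP; rewrite ?e1 ?cxy // e3; split=> // i /H; lia.
  have [_ H] := (run_keyP _ _ _ sn zx).1 (esym key).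
  rewrite eq_sym; apply/eqP/run_keyP; rewrite ?e1 ?cxy // e3; split=> // i /H; lia.
have [_ xP] := partition_pblock _ x parP xD.
have [_ yP] := partition_pblock _ y parP yD.
have [sx sxm] := tstartP _ (block_neq0 x xD); have [ex exm] := tendP _ (block_neq0 x xD).
have [_ sym] := tstartP _ (block_neq0 y yD); have [_ eym] := tendP _ (block_neq0 y yD).
have [z1 /sym + e1] := sub _ sx; have [z2 /eym + e2] := sub _ ex.
by rewrite e1 e2 => -> ->.
Qed.

End OfLabeling.

(** The tiling determines each label: [j] is below the label at [c] iff the nodes of layer [j] in
    columns [c] and [c.+1] share a tile. *)
Lemma tiling_of_inj n n' : valid_labeling n -> valid_labeling n' ->
  tiling_of n = tiling_of n' -> n = n'.
Proof.
move=> nP n'P e; have [sn _ _] := nP; have [sn' _ _] := n'P.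
have half m m' c j : valid_labeling m -> valid_labeling m' ->
    tiling_of m = tiling_of m' -> c < k ->
    j < nth 0 m c -> j < nth 0 m' c.
  move=> mP m'P em ck jm; have [d1 d2] := labeling_layer m mP j c ck jm.
  have [e1 _ D1 l1] := at_layerP j c (ltnW ck) d1.
  have [e2 _ D2 l2] := at_layerP j c.+1 ck d2.
  have cc : colN (at_layer j c) <= colN (at_layer j c.+1) by rewrite e1 e2.
  have : at_layer j c.+1 \in pblock (tiling_of m) (at_layer j c).
    apply/mem_pblockP => //; rewrite e1 e2 l1 l2; split=> // i ic.
    by have -> : i = c by lia.
  rewrite em => /(mem_pblockP m' m'P)[] // _ /(_ c); rewrite e1 e2 l1; apply; lia.
apply: (@eq_from_nth _ 0) => [|c]; rewrite ?sn ?sn' // => ck.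
apply/eqP; rewrite eqn_leq; apply/andP; split; rewrite leqNgt; apply/negP => lt.
  by have := half n n' c _ nP n'P e ck lt; rewrite ltnn.
by have := half n' n c _ n'P nP (esym e) ck lt; rewrite ltnn.
Qed.

(** * From tilings to chord labellings *)

Section OfTiling.
Variable P : {set {set node f g}}.
Hypothesis parP : partition P D.
Hypothesis dyckP : forall T, T \in P -> is_dyck T.
Hypothesis coverP : cover_incl P D.
Local Notation B := (pblock P).

Let BP x : x \in D -> B x \in P.
Proof. by move=> xD; case: (partition_pblock _ x parP xD). Qed.
Let xB x : x \in D -> x \in B x.
Proof. by move=> xD; case: (partition_pblock _ x parP xD). Qed.
Let BD x y : y \in B x -> y \in D. Proof. exact: partition_pblockD. Qed.
Let BE x y : y \in B x -> B y = B x.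
Proof. exact/same_pblock/partition_trivIset/parP. Qed.
Let tileB x : x \in D -> is_tile (B x).
Proof. by move=> xD; case/and3P: (dyckP _ (BP x xD)). Qed.

Let startP x : x \in D -> tstart (B x) \in B x /\
  (forall z, z \in B x -> colN (tstart (B x)) <= colN z).
Proof. by move/tileB/tile_neq0/tstartP. Qed.

Let endP x : x \in D -> tend (B x) \in B x /\
  (forall z, z \in B x -> colN z <= colN (tend (B x))).
Proof. by move/tileB/tile_neq0/tendP. Qed.

Let layer_above x : x \in D -> 0 < layer x ->
  exists y, [/\ y \in D, colN y = colN x, y.2 = x.2.+1 :> nat & layer x = (layer y).+1].
Proof.
move=> xD x0; have d := layer_lt x xD.
have [|e1 e2 yD e3] := at_layerP (layer x).-1 (colN x) (colN_le x); first by lia.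
exists (at_layer (layer x).-1 (colN x)); split=> //; rewrite ?e2 ?e3; last by lia.
by move: xD x0; rewrite memD /layer; lia.
Qed.

(** A tile meets an interval of columns, so comparing starts and ends amounts to inclusion of these
    intervals. *)
Let cover_col x y c : x \in D -> y \in D -> colN y = colN x -> y.2 = x.2.+1 :> nat ->
  (exists2 z, z \in B x & colN z = c) -> exists2 z, z \in B y & colN z = c.
Proof.
move=> xD yD cxy y2 [z zx <-].
have [sxy exy] := (cover_inclP P).1 coverP x y cxy y2 xD yD.
have [sy _] := startP y yD; have [ey _] := endP y yD.
apply: (tile_col_between _ (tileB y yD) _ _ _ sy ey); apply/andP; split.
  by apply: leq_trans sxy _; have [_ ->] := startP x xD.
by apply: leq_trans exy; have [_ ->] := endP x xD.
Qed.

Let col_inj x y z : x \in D -> y \in B x -> z \in B x -> colN y = colN z -> y = z.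
Proof. by move=> xD yx zx; apply: tile_col_inj yx zx; apply: tileB. Qed.

(* If a tile changed layer between two columns, cover-inclusiveness would force the
   tile just above to do the same, and so on up to the top layer. *)
Let layer_step x y : x \in D -> y \in B x -> colN y = (colN x).+1 -> layer y = layer x.
Proof.
have [m] := ubnP (layer x); elim: m x y => // m IHm x y; rewrite ltnS => xm xD yx cxy.
have yD := BD _ _ yx; have By := BE _ _ yx; have xx := xB x xD.
have := tile_step _ (tileB x xD) x y xx yx cxy; rewrite tstepE => /andP[_ y2].
have := uS _ (colN_lt x xD); rewrite -cxy => uE.
move: (xD) (yD); rewrite !memD => xb yb.
have [ly | layer_ne] := eqVneq (layer y) (layer x); first by [].
(* At a U of the rim a change of layer is an SE step, one layer deeper. The tile of the node [y']
   above [y] meets the column of [x] either in [x], which puts two nodes of one tile in a column, or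
   just above [x], where the same change recurs in a smaller layer. *)
case: (W (colN x)) in uE *.
  have {}y2 : y.2 = x.2 :> nat.
    by case/orP: y2 => /eqP y2 //; move: layer_ne; rewrite /layer uE addn1 y2 subSS eqxx.
  have lyx : layer y = (layer x).+1.
    by move: xb; rewrite /layer uE addn1 y2 => /andP[_ /subSn].
  have [|y' [y'D cy' y'2 ly']] := layer_above y yD; first by rewrite lyx.
  have [|z zy' cz] := cover_col y y' (colN x) yD y'D cy' y'2.
    by exists x => //; rewrite By.
  have zD := BD _ _ zy'; have cy'z : colN y' = (colN z).+1 by rewrite cy' cz.
  have y'z : y' \in B z by rewrite (BE _ _ zy') xB.
  have := tile_step _ (tileB z zD) z y' (xB z zD) y'z cy'z.
  rewrite tstepE => /andP[_ /orP[]/eqP e].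
    have lz : layer x = (layer z).+1.
      by move: (zD); rewrite memD /layer cz -e y'2 y2 => /andP[_ /subnSK].
    have ly'x : layer y' = layer x by apply: succn_inj; rewrite -ly'.
    have := IHm z y' _ zD y'z cy'z; rewrite -lz ly'x => /(_ xm) xz.
    by case: (n_Sn (layer z)); rewrite -{1}xz.
  have zx : z = x by apply: node_eq => //; apply: succn_inj; rewrite -e y'2 y2.
  have := col_inj x y y' xD yx _ (esym cy'); rewrite -zx => /(_ y'z) yy'.
  by move: y'2; rewrite -yy' => /n_Sn.
(* At a D the change is an NE step, one layer up; now the tile of the node [x'] above [x] is
   followed into the column of [y]. *)
have {}y2 : y.2 = x.2.+1 :> nat.
  by case/orP: y2 => /eqP y2 //; move: layer_ne; rewrite /layer uE addn0 y2 eqxx.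
have lxy : layer x = (layer y).+1.
  by move: yb; rewrite /layer uE addn0 y2 => /andP[_ /subnSK].
have [|x' [x'D cx' x'2 lx']] := layer_above x xD; first by rewrite lxy.
have [|z zx' cz] := cover_col x x' (colN y) xD x'D cx' x'2.
  by exists y.
have zD := BD _ _ zx'; have czx' : colN z = (colN x').+1 by rewrite cx' cz.
have := tile_step _ (tileB x' x'D) x' z (xB x' x'D) zx' czx'.
rewrite tstepE => /andP[_ /orP[]/eqP e].
  have zy : z = y by apply: node_eq => //; rewrite e x'2 y2.
  have x'x : x' \in B x by rewrite -By -zy (BE _ _ zx') xB.
  have := col_inj x x x' xD xx x'x (esym cx') => xx'.
  by move: x'2; rewrite -xx' => /n_Sn.
have lz : layer y = (layer z).+1.
  by move: (zD); rewrite memD /layer cz e x'2 y2 => /andP[_ /subnSK].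
have lx'y : layer x' = layer y by apply: succn_inj; rewrite -lx'.
have := IHm x' z _ x'D zx' czx'; rewrite -lx' lx'y => /(_ xm) yz.
by case: (n_Sn (layer z)); rewrite -lz yz.
Qed.

Let block_layer x y z : x \in D -> y \in B x -> z \in B x -> colN y <= colN z ->
  layer y = layer z.
Proof.
move=> xD yx; move e : (colN z - colN y) => m; elim: m z e => [|m IHm] z e zx yz.
  by rewrite (col_inj x y z) //; lia.
have [|t tx ct] := tile_col_between _ (tileB x xD) y z (colN z).-1 yx zx; first by lia.
have tD := BD _ _ tx; rewrite (IHm t) ?ct //; try lia.
by apply/esym/layer_step; rewrite ?(BE _ _ tx) //; lia.
Qed.

Lemma same_layer x y : x \in D -> y \in B x -> layer y = layer x.
Proof.
move=> xD yx; have xx := xB x xD; have [xy|/ltnW xy] := leqP (colN x) (colN y).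
  exact/esym/(block_layer x).
exact: (block_layer x).
Qed.

Let node_at x c : x \in D -> (exists2 z, z \in B x & colN z = c) ->
  at_layer (layer x) c \in B x /\ v c + layer x < u c.
Proof.
move=> xD [z zx <-]; have zD := BD _ _ zx.
by rewrite -(same_layer x z) // -at_layer_layer //; split=> //; apply: layer_lt.
Qed.

Definition linked c j := [&& v c + j < u c, v c.+1 + j < u c.+1 &
  at_layer j c.+1 \in B (at_layer j c)].

(** Cover-inclusiveness passes a crossing of step [c] up to all higher layers, so the crossings are
    counted by the first layer without one. *)
Let linked_mono c i j : c < k -> i <= j -> linked c j -> linked c i.
Proof.
move=> ck; elim: j => [|j IHj]; first by rewrite leqn0 => /eqP->.
rewrite leq_eqVlt => /predU1P[->//|/IHj IH /and3P[d1 d2 y1]]; apply: IH.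
have d1' : v c + j < u c by lia.
have d2' : v c.+1 + j < u c.+1 by lia.
rewrite /linked d1' d2' /=.
have [e1 e2 xD lx] := at_layerP j.+1 c (ltnW ck) d1.
have [e1' e2' yD ly] := at_layerP j c (ltnW ck) d1'.
have [ez _ _ _] := at_layerP j.+1 c.+1 ck d2.
have [] := node_at _ c.+1 yD; last by rewrite ly.
apply: (cover_col _ _ _ xD yD).
- by rewrite e1 e1'.
- by rewrite e2 e2'; lia.
by exists (at_layer j.+1 c.+1).
Qed.

(** The range [f.+1] always contains an unlinked layer, since [linked c j] forces [j < u c <= f]. *)
Definition labeling_of : seq nat :=
  mkseq (fun c => find (predC (linked c)) (iota 0 f.+1)) k.

Lemma nth_labeling_of c j : c < k -> (j < nth 0 labeling_of c) = linked c j.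
Proof.
move=> ck; rewrite nth_mkseq //; set p := find _ _.
have jf i : linked c i -> i < f.
  by case/and3P=> d _ _; have := u_f c (ltnW ck); lia.
have pf : p <= f.+1 by rewrite -[f.+1 in leqRHS](size_iota 0) find_size.
apply/idP/idP => [jp | lj].
  by have := before_find 0 jp; rewrite nth_iota /= ?add0n => [/negbFE|]; lia.
rewrite ltnNge; apply/negP => pj; have jf' := jf j lj.
have pi : p < size (iota 0 f.+1) by rewrite size_iota; lia.
have hp : has (predC (linked c)) (iota 0 f.+1) by rewrite has_find.
have := nth_find 0 hp; rewrite -/p nth_iota /= ?(linked_mono c p j) //; lia.
Qed.

Lemma size_labeling_of : size labeling_of = k. Proof. exact: size_mkseq. Qed.

Lemma mem_block x y : x \in D -> y \in D -> colN x <= colN y ->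
  (y \in B x) = (run_key labeling_of x == run_key labeling_of y).
Proof.
move=> xD yD xy; have sn := size_labeling_of.
apply/idP/eqP => [yx | /(run_keyP _ _ _ sn xy)[e H]].
  apply/(run_keyP _ _ _ sn xy); split=> [|i ixy]; first by rewrite (same_layer x y).
  have ik : i < k by have := colN_lt y yD; lia.
  have xx := xB x xD; have tx := tileB x xD.
  have at_col c : colN x <= c <= colN y ->
      at_layer (layer x) c \in B x /\ v c + layer x < u c.
    by move=> cxy; apply: node_at => //; apply: tile_col_between tx _ _ _ xx yx cxy.
  have [|xi di] := at_col i; first by lia.
  have [|xi1 di1] := at_col i.+1; first by lia.
  by rewrite nth_labeling_of // /linked di di1 (BE _ _ xi).
suff at_col c : colN x <= c <= colN y -> at_layer (layer x) c \in B x.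
  by rewrite (at_layer_layer y yD) -e at_col // xy leqnn.
elim: c => [|c IHc] cxy.
  have <- : colN x = 0 by lia.
  by rewrite -at_layer_layer ?xB.
have [<-|xc] := eqVneq (colN x) c.+1; first by rewrite -at_layer_layer ?xB.
have xc1 : at_layer (layer x) c \in B x by apply: IHc; lia.
have ck : c < k by have := colN_lt y yD; lia.
have : linked c (layer x) by rewrite -nth_labeling_of //; apply: H; lia.
by case/and3P=> _ _; rewrite (BE _ _ xc1).
Qed.

Lemma tiling_of_labeling_of : tiling_of labeling_of = P.
Proof.
rewrite -[RHS](equivalence_partition_pblock parP) /tiling_of /preim_partition.
have E x y : x \in D -> y \in D ->
    (run_key labeling_of x == run_key labeling_of y) = (y \in B x).
  move=> xD yD; have [xy|/ltnW yx] := leqP (colN x) (colN y); first by rewrite mem_block.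
  by rewrite eq_sym -mem_block //; apply/idP/idP => h; rewrite (BE _ _ h) xB.
apply: eq_in_imset => x xD; apply/setP => y; rewrite !inE.
by case yD : (y \in D) => //=; rewrite E.
Qed.

Let height_le x z : x \in D -> z \in B x -> height z <= height (tstart (B x)).
Proof.
move=> xD zx; have /and3P[_ /eqP-> _] := dyckP _ (BP x xD).
by apply: leq_bigmax_cond.
Qed.

Let height_end x : x \in D -> height (tend (B x)) = height (tstart (B x)).
Proof. by move=> xD; have /and3P[_ /eqP-> /eqP->] := dyckP _ (BP x xD). Qed.

Lemma labeling_of_valid : valid_labeling labeling_of.
Proof.
split=> [|c ck|j]; first exact: size_labeling_of.
  case e : (nth 0 labeling_of c) => [|m]; first by rewrite !add0n !vu // ltnW.
  have : linked c m by rewrite -nth_labeling_of // e.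
  by case/and3P; lia.
(* The depth is the drop below the start of the tile, and 0 where column [c] has no node in layer
   [j]. *)
pose r c := if v c + j < u c
  then height (tstart (B (at_layer j c))) - height (at_layer j c) else 0.
exists r; split.
- by rewrite /r; have := u_c 0 (leq0n _); case: ifP => //; lia.
- by rewrite /r uvk; case: ifP => //; lia.
move=> c ck; rewrite nth_labeling_of // /depth_step; case: ifPn => lc.
  case/and3P: (lc) => d1 d2 xx'; rewrite /r d1 d2.
  have [e1 e2 D1 _] := at_layerP j c (ltnW ck) d1.
  have [e1' e2' D2 _] := at_layerP j c.+1 ck d2.
  have := height_le _ _ D1 xx'; have := height_le _ _ D1 (xB _ D1).
  rewrite (BE _ _ xx').
  have := height_colN (at_layer j c); have := height_colN (at_layer j c.+1).
  rewrite e1 e1' e2 e2' (uS c ck); case: (W c); lia.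
(* At an unlinked step the node on the left ends its tile and the one on the right starts its tile;
   both have maximal height. *)
apply/andP; split; rewrite /r; case: ifP => // d1.
  have [e1 e2 xD lx] := at_layerP j c (ltnW ck) d1; set x := at_layer j c in e1 e2 xD lx *.
  have [ex exm] := endP x xD.
  suff <- : tend (B x) = x by rewrite (BE _ _ ex) height_end // subnn.
  apply: (col_inj x) => //; rewrite ?xB //; apply/eqP.
  rewrite eqn_leq exm ?xB // andbT leqNgt; apply: contra lc => lt.
  have [|xc d2] := node_at x c.+1 xD.
    by apply: tile_col_between (tileB x xD) _ _ _ (xB x xD) ex _; rewrite e1 in lt *; lia.
  by rewrite /linked d1 -{1}lx d2 -/x -{1}lx.
have [e1 e2 xD lx] := at_layerP j c.+1 ck d1; set x := at_layer j c.+1 in e1 e2 xD lx *.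
have [sx sxm] := startP x xD.
suff -> : tstart (B x) = x by rewrite subnn.
apply: (col_inj x) => //; rewrite ?xB //; apply/eqP.
rewrite eqn_leq sxm ?xB //= leqNgt; apply: contra lc => lt.
have [|xc d2] := node_at x c xD.
  by apply: tile_col_between (tileB x xD) _ _ _ sx (xB x xD) _; rewrite e1 in lt *; lia.
by rewrite /linked d1 lx in d2 xc *; rewrite d2 /= (BE _ _ xc) xB.
Qed.

End OfTiling.

Theorem card_tilings (L : seq (seq nat)) : uniq L ->
    (forall n, n \in L <-> valid_labeling n) ->
  #|[set P | tiling_ok P]| = size L.
Proof.
move=> uL LP; rewrite -(size_map tiling_of).
have uT : uniq (map tiling_of L).
  by rewrite map_inj_in_uniq // => n n' /LP nP /LP n'P; apply: tiling_of_inj.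
rewrite -(card_uniqP uT); apply: eq_card => P; rewrite inE; apply/idP/mapP.
  case/andP=> /andP[parP /forall_inP dyckP] coverP; exists (labeling_of P).
    exact/LP/labeling_of_valid.
  by rewrite tiling_of_labeling_of.
by case=> n /LP nP ->; apply: tiling_of_ok.
Qed.

End Tilings.

(** * Partitions *)

Definition part_word {f g} (lam : part f g) : seq bool := rows_word f (map val lam).

Section Partition.
Context {f g : nat}.
Implicit Types lam mu : part f g.

Lemma size_rows lam : size (map val lam) = g.
Proof. by rewrite size_map size_tuple. Qed.

Lemma path_rows lam : is_part lam -> path geq f (map val lam).
Proof.
rewrite /is_part; case: lam => [[|x l] /= _] // ->; rewrite andbT.
by rewrite -ltnS ltn_ord.
Qed.

Lemma wordE lam : word lam = rows_gens f (map val lam).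
Proof. by rewrite -rows_gensE size_rows. Qed.

Lemma size_part_word lam : is_part lam -> size (part_word lam) = f + g.
Proof. by move=> pl; rewrite size_rows_word ?path_rows // size_rows. Qed.

Lemma count_part_word lam : is_part lam -> count id (part_word lam) = f.
Proof. by move=> pl; rewrite count_rows_word ?path_rows. Qed.

Definition ups (w : seq bool) c := count id (take c w).

Lemma ups_le w c : ups w c <= c.
Proof. by apply: leq_trans (count_size _ _) _; rewrite size_take_min geq_minl. Qed.

Lemma ups_le_count w c : ups w c <= count id w.
Proof. exact/leq_count_subseq/take_subseq. Qed.

Lemma leq_ups w c : c <= size w -> c <= ups w c + count (predC id) w.
Proof.
move=> cw; have := count_predC id (take c w); rewrite size_takel // => {1}<-.
by rewrite leq_add2l; apply/leq_count_subseq/take_subseq.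
Qed.

Lemma count_downs lam : is_part lam -> count (predC id) (part_word lam) = g.
Proof.
by move=> pl; have := count_predC id (part_word lam);
   rewrite count_part_word // size_part_word // => /addnI.
Qed.

Lemma mem_ydiag lam (x : node f g) : is_part lam ->
  (x \in ydiag lam) = [&& 0 < x.1, 0 < x.2 & x.2 <= ups (part_word lam) (colN x)].
Proof.
move=> pl; rewrite inE; case: (posnP x.1) => // x1 /=; congr (_ && _).
rewrite /prt (leq_row f _ x.1) ?path_rows ?size_rows ?x1 //=.
  by rewrite -ltnS.
by rewrite -ltnS.
Qed.

(* [Defs.skew] is shadowed by the sesquilinear [skew] of MathComp. *)
Lemma mem_skew lam mu (x : node f g) : is_part lam -> is_part mu ->
  (x \in Defs.skew lam mu) =
  (ups (part_word mu) (colN x) < x.2 <= ups (part_word lam) (colN x)).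
Proof.
move=> pl pm; rewrite inE !mem_ydiag //.
have := leq_ups (part_word mu) (colN x); rewrite size_part_word // count_downs //.
move=> /(_ (colN_le _)); rewrite {1}/colN; lia.
Qed.

Lemma ydiag_sub lam mu : is_part lam -> is_part mu ->
  (ydiag mu \subset ydiag lam) <->
  (forall c, c <= f + g -> ups (part_word mu) c <= ups (part_word lam) c).
Proof.
move=> pl pm; split=> [/subsetP sub c ck | H]; last first.
  apply/subsetP => x; rewrite !mem_ydiag // => /and3P[-> -> xm] /=.
  by apply: leq_trans xm (H _ (colN_le _)).
rewrite leqNgt; apply/negP => lt.
have := leq_ups (part_word lam) c; rewrite size_part_word // count_downs // => /(_ ck) lc.
have := ups_le_count (part_word mu) c; rewrite count_part_word // => mf.
have mc := ups_le (part_word mu) c.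
(* The top node of [mu] in column [c], which [lam] would miss. *)
pose x : node f g := (inord (ups (part_word mu) c + g - c), inord (ups (part_word mu) c)).
have e1 : x.1 = ups (part_word mu) c + g - c :> nat by rewrite inordK //; lia.
have e2 : x.2 = ups (part_word mu) c :> nat by rewrite inordK //; lia.
have ec : colN x = c by rewrite /colN e1 e2; lia.
by have := sub x; rewrite !mem_ydiag // ec e1 e2; lia.
Qed.

Lemma iDT_nb_labelings lam mu : is_part lam -> is_part mu ->
  iDT lam mu = nb_labelings [::] 0 (part_word lam) (part_word mu).
Proof.
move=> pl pm; have sl := size_part_word lam pl; have sm := size_part_word mu pm.
have cl := count_part_word lam pl; have cm := count_part_word mu pm.
have LP n : n \in labelings [::] 0 (part_word lam) (part_word mu) <->
    valid_labeling f g (ups (part_word lam)) (ups (part_word mu)) (nth false (part_word lam)) n.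
  rewrite labelingsP ?sl ?sm //; rewrite /label_spec sl cl cm.
  split=> [[sn _ bd dk] | [sn bd dk]].
    split=> // j; have := dk j; rewrite dyck_runsP ?size_map ?sn ?sl // => -[r [r0 rk rS]].
    exists r; split=> // c ck; have := rS c ck.
    by rewrite (nth_map 0) ?sn.
  split=> // j; rewrite dyck_runsP ?size_map ?sn ?sl //.
  have [r [r0 rk rS]] := dk j; exists r; split=> // c ck.
  by rewrite (nth_map 0) ?sn //; apply: rS.
have upk : ups (part_word lam) (f + g) = ups (part_word mu) (f + g).
  by rewrite /ups -{1}sl -sm !take_size cl cm.
rewrite /iDT; case: ifPn => [/ydiag_sub sub | /negP nsub].
  apply: (@card_tilings f g (ups (part_word lam)) (ups (part_word mu)) (nth false (part_word lam)));
    rewrite ?labelings_uniq //; do ?by [].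
  - by move=> c ck; rewrite /ups (take_nth false) ?sl // -cats1 count_cat /= addn0.
  - by move=> c _; rewrite -[leqRHS]cl ups_le_count.
  - by move=> c _; apply: ups_le.
  - by move=> c ck; rewrite -[X in _ + X](count_downs mu) // leq_ups // sm.
  - exact: sub.
  by move=> x; apply: mem_skew.
(* A single labelling would already force [mu] inside [lam], as labels are nonnegative and bounded
   by the distance. *)
apply/esym/eqP; rewrite size_eq0; apply/eqP/nilP.
case e : (labelings _ _ _ _) => [//|n L]; case: nsub; apply/ydiag_sub => // c.
have [_ bd _] : valid_labeling f g (ups (part_word lam)) (ups (part_word mu)) (nth false (part_word lam)) n.
  by apply/LP; rewrite e mem_head.
by rewrite leq_eqVlt => /predU1P[->|/bd]; rewrite ?upk //; lia.
Qed.

Lemma perm_part_word :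
  perm_eq [seq part_word lam | lam <- enum (@is_part f g)]
          [seq w <- words (f + g) | count id w == f].
Proof.
apply: uniq_perm => [||w]; last 1 first.
- rewrite mem_filter mem_words; apply/mapP/andP => [[lam + ->] | [/eqP cw /eqP sw]].
    by rewrite mem_enum => pl; rewrite count_part_word // size_part_word.
  have [l [sl pl <-]] := rows_word_surj f g w sw cw.
  have sl' : size (map (@inord f) l) == g by rewrite size_map sl.
  have e : map val (Tuple sl') = l.
    rewrite -map_comp map_id_in // => x xl /=; rewrite inordK // ltnS.
    by have /allP/(_ x xl) := order_path_min (rev_trans leq_trans) pl.
  exists (Tuple sl'); last by rewrite /part_word e.
  by rewrite mem_enum unfold_in /is_part e (path_sorted pl).
- rewrite map_inj_in_uniq ?enum_uniq // => lam mu; rewrite !mem_enum => pl pm e.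
  apply: val_inj; apply: (inj_map val_inj).
  exact: (rows_word_inj f) (path_rows lam pl) (path_rows mu pm) e.
by rewrite filter_uniq ?words_uniq.
Qed.

End Partition.

Theorem theorem5p4 (F : fieldType) (f g : nat) (mu : part f g) :
  is_part mu ->
  tw_act (word mu) (mgen F f g) =
  (\sum_(lam : part f g | is_part lam)
     sw_act (word lam) (mgen F f g) *+ iDT lam mu)%R.
Proof.
move=> pm; apply/ffunP => B; rewrite sum_ffunE.
rewrite wordE tw_act_rows_gens ?size_rows ?path_rows // ffunE.
have sm := size_part_word mu pm; have sB := size_inword _ B.
rewrite -[rows_word _ _]/(part_word mu).
rewrite -sum_cup_coef_labelings ?sm ?sB // (bigID (fun w => count id w == f)) /=.
(* Words with another number of U's have no labelling, because a labelling forces equal counts. *)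
rewrite [X in (_ + X)%R]big_seq_cond [X in (_ + X)%R]big1 ?addr0; last first.
  move=> w; rewrite mem_words => /andP[/eqP sw cw].
  have -> : nb_labelings [::] 0 w (part_word mu) = 0; last by [].
  apply/eqP; rewrite size_eq0; case e : (labelings _ _ _ _) => [//|n L].
  have [_ cwf _ _] : label_spec [::] 0 w (part_word mu) n.
    by apply/labelingsP; rewrite ?e ?mem_head ?sw ?sm.
  by move: cwf cw; rewrite add0n count_part_word // => ->; rewrite eqxx.
rewrite -big_filter -(perm_big _ perm_part_word) big_map big_enum_cond /=.
apply: eq_big => [lam|lam]; first by rewrite andbT.
rewrite andbT => pl.
by rewrite wordE sw_act_rows_gens ?size_rows ?path_rows // ffunMnE ffunE iDT_nb_labelings.
Qed.
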